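(* Let $G$ be a finite abelian-by-metanilpotent group. Then for any three distinct non-linear irreducible complex characters $\chi_1,\chi_2,\chi_3$ of $G$, there exist $i\neq j$ in $\{1,2,3\}$ and $g\in G$ with $\chi_i(g)=0=\chi_j(g)$.
   Context: A finite group $G$ is abelian-by-metanilpotent if there exist normal subgroups $N\le K$ of $G$ such that $N$ is abelian and both $K/N$ and $G/K$ are nilpotent. A character $\chi$ is non-linear if $\chi(1)>1$. *)

(* Defs.v *)
From mathcomp Require Import all_boot all_order all_algebra all_fingroup all_solvable all_field all_character.
Set Implicit Arguments. Unset Strict Implicit. Unset Printing Implicit Defensive.

Import GroupScope.

Definition abelian_by_metanilpotent (gT : finGroupType) (G : {group gT}) : Prop :=
  exists N K : {group gT},
    [/\ N <| G, K <| G, N \subset K,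
        abelian N & nilpotent (K / N) /\ nilpotent (G / K)].

(* Main.v *)
(** If [K <| G] with [G / K] nilpotent, an irreducible character of [G] either
    restricts irreducibly to [K] or vanishes off a proper subgroup of [G].
    Since a group is not the union of two proper subgroups, two characters of
    the second kind have a common zero.  Two non-linear characters of the first
    kind also have one, in [K]: apply the dichotomy to their restrictions to
    [K] and the abelian group [N], to which a non-linear character cannot
    restrict irreducibly.  Among three characters, two are of the same kind. *)
Require Import Defs.
From mathcomp Require Import all_boot all_order all_algebra all_fingroup all_solvable all_field all_character.
Import GroupScope GRing.Theory Num.Theory.

(** By the Clifford correspondence, ['chi_i] is induced from the inertia group of ['chi_t], which is
    proper in [G]. Nilpotency of [G / K] encloses that group in a proper normal subgroup of [G], off
    which the induced character vanishes. *)
Lemma not_invariant_vanish_off_proper (gT : finGroupType) (G K : {group gT})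
    (i : Iirr G) (t : Iirr K) :
  K <| G -> nilpotent (G / K) -> t \in irr_constt ('Res[K] 'chi_i)%R ->
  ~~ (G \subset 'I[('chi_t)%R]) ->
  exists2 H : {group gT}, H \proper G & ('chi_i \in 'CF(G, H))%R.
Proof.
move=> nsKG nilGK iK_t not_invt.
have sKG := normal_sub nsKG.
have sKT : K \subset 'I_G[('chi_t)%R] by apply: sub_Inertia.
have [_ _ Indim _ _] := constt_Inertia_bijection t nsKG.
have: i \in irr_constt ('Ind[G] 'chi_t)%R by rewrite constt_Ind_Res.
rewrite -Indim => /imsetP[s /[dup] tT_s].
have [IndT _ _ _ _] := constt_Inertia_bijection t nsKG.
move/IndT=> irr_s def_i.
have chi_i : ('chi_i = 'Ind[G] 'chi_s)%R by rewrite def_i cfIirrE.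
(* Subgroups of a nilpotent group are subnormal, so a proper one lies in a proper normal subgroup
   [Mbar], which is then pulled back to [M]. *)
have := nilpotent_subnormal nilGK (quotientS K (subsetIl G 'I[('chi_t)%R])).
case/subnormalEr=> [eqTG | [Mbar [/subnormal_sub sTM nsMG prMG]]].
  case/negP: not_invt; apply/setIidPl.
  exact: quotient_inj (normal_Inertia _ sKG) nsKG eqTG.
case: (inv_quotientN nsKG nsMG) => M defM sKM nsMG'.
exists M.
  rewrite properEneq normal_sub // andbT; apply: contraTneq prMG => eqMG.
  by rewrite defM eqMG properxx.
have sTM' : 'I_G[('chi_t)%R] \subset M.
  by rewrite -(quotientSGK _ sKM) ?norm_Inertia -?defM.
(* Induce in stages through the normal subgroup [M]. *)
by rewrite chi_i -(cfIndInd _ (normal_sub nsMG') sTM') cfInd_normal.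
Qed.

(** The nontrivial centre of [G / K] contains an element of prime order; the subgroup it generates
    is central, hence normal, and [L] is its preimage. *)
Lemma nilpotent_quotient_prime_step (gT : finGroupType) (G K : {group gT}) :
  K <| G -> nilpotent (G / K) -> K \proper G ->
  exists2 L : {group gT}, L <| G & K \subset L /\ prime #|L : K|.
Proof.
move=> nsKG nilGK /andP[_ not_sGK].
have ntZ : 'Z(G / K) != 1.
  by rewrite center_nil_eq1 // -subG1 quotient_sub1 ?normal_norm.
have [x Zx ox] := Cauchy (pdiv_prime (etrans (cardG_gt1 _) ntZ)) (pdiv_dvd _).
have nsxG : <[x]> <| G / K by rewrite sub_center_normal ?cycle_subG.
case: (inv_quotientN nsKG nsxG) => L defL sKL nsLG.
exists L => //; split=> //.
rewrite -card_quotient ?(subset_trans (normal_sub nsLG)) ?normal_norm //.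
by rewrite -defL -orderE ox pdiv_prime // cardG_gt1.
Qed.

(** Induction on the index of [K]. If the restriction to the intermediate [L] is irreducible,
    primality of the index of [K] in [L] leaves two cases: the restriction stays irreducible on [K],
    or it splits into distinct constituents that are not invariant in [G]. *)
Lemma cfRes_irr_or_vanish_off_proper (gT : finGroupType) (G K : {group gT})
    (i : Iirr G) :
  K <| G -> nilpotent (G / K) ->
  ('Res[K] 'chi_i \in irr K)%R
  \/ exists2 H : {group gT}, H \proper G & ('chi_i \in 'CF(G, H))%R.
Proof.
have [n] := ubnP #|G : K|; elim: n K => // n IHn K ltGKn nsKG nilGK.
have sKG := normal_sub nsKG.
have [sGK | not_sGK] := boolP (G \subset K).
  have eqGK : K = G by apply/group_inj/eqP; rewrite eqEsubset sKG.
  by left; rewrite eqGK cfRes_id mem_irr.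
have prKG : K \proper G by rewrite properE sKG.
have [L nsLG [sKL prLK]] := nilpotent_quotient_prime_step _ _ _ nsKG nilGK prKG.
have sLG := normal_sub nsLG.
have nsKL : K <| L := normalS sKL sLG nsKG.
have nilGL : nilpotent (G / L).
  by rewrite -(isog_nil (third_isog sKL nsKG nsLG)) quotient_nil.
have ltGLn : #|G : L| < n.
  rewrite -ltnS; apply: leq_trans ltGKn; rewrite ltnS -(Lagrange_index sLG sKL).
  by rewrite ltn_Pmulr ?prime_gt1.
have [/irrP[j def_j]|] := IHn L ltGLn nsLG nilGL; last by right.
have ResK : ('Res[K] 'chi_i = 'Res[K] 'chi_j)%R by rewrite -def_j cfResRes.
rewrite ResK.
have [|[c inj_c sum_c]] := cfRes_prime_irr_cases j nsKL erefl prLK.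
  by left.
right; set p := #|L : K| in c inj_c sum_c prLK.
(* Since [p > 1] there are two distinct constituents. Were [c0] invariant under [L], Clifford's
   theorem would make the restriction a multiple of ['chi_c0], excluding [c1]. *)
pose c0 := c (Ordinal (prime_gt0 prLK)); pose c1 := c (Ordinal (prime_gt1 prLK)).
have constt_c k : c k \in irr_constt ('Res[K] 'chi_j)%R.
  rewrite irr_consttE sum_c cfdot_suml (bigD1 k) //= cfnorm_irr big1 ?addr0.
    exact: oner_neq0.
  by move=> l ne_lk; rewrite cfdot_irr (inj_eq inj_c) (negPf ne_lk).
apply: (not_invariant_vanish_off_proper _ _ _ _ c0 nsKG nilGK).
  by rewrite ResK constt_c.
(* The [p] distinct constituents of [chi_j] on [K] are conjugate under [L]. *)
apply/negP=> /(subset_trans sLG)/cfclass_invariant clc0.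
have := constt_c (Ordinal (prime_gt1 prLK)).
rewrite irr_consttE (Clifford_Res_sum_cfclass nsKL (constt_c _ : c0 \in _)) clc0.
by rewrite big_seq1 cfdotZl cfdot_irr (inj_eq inj_c) mulr0 eqxx.
Qed.

Lemma vanish_off_proper_common_zero (gT : finGroupType) (G H1 H2 : {group gT})
    (phi psi : 'CF(G)) :
  H1 \proper G -> H2 \proper G ->
  (phi \in 'CF(G, H1))%R -> (psi \in 'CF(G, H2))%R ->
  exists2 g, g \in G & (phi g = 0 /\ psi g = 0)%R.
Proof.
move=> prH1 prH2 phiH1 psiH2.
suffices [g Gg notHg] : exists2 g, g \in G & g \notin H1 :|: H2.
  exists g => //; move: notHg; rewrite inE negb_or => /andP[H1'g H2'g].
  by rewrite (cfun_on0 phiH1) ?(cfun_on0 psiH2).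
apply/subsetPn/negP=> sGU.
have [/andP[sH1G /subsetPn[x Gx H1'x]] /andP[sH2G /subsetPn[y Gy H2'y]]] :=
  (prH1, prH2).
have H2x : x \in H2 by have:= subsetP sGU x Gx; rewrite inE (negPf H1'x).
have H1y : y \in H1.
  by have:= subsetP sGU y Gy; rewrite inE (negPf H2'y) orbF.
(* As [x] lies only in [H2] and [y] only in [H1], their product lies in neither. *)
have:= subsetP sGU _ (groupM Gx Gy).
by rewrite inE groupMr // groupMl // (negPf H1'x) (negPf H2'y).
Qed.

Lemma abelian_nilpotent_vanish_off_proper (gT : finGroupType)
    (N K : {group gT}) (chi : 'CF(K)) :
  N <| K -> abelian N -> nilpotent (K / N) ->
  (chi \in irr K)%R -> (1 < chi 1%g)%R ->
  exists2 H : {group gT}, H \proper K & (chi \in 'CF(K, H))%R.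
Proof.
move=> nsNK abN nilKN /irrP[i ->] nonlin.
have [/irrP[j res_j] | //] := cfRes_irr_or_vanish_off_proper _ _ _ i nsNK nilKN.
have:= lin_char1 (char_abelianP _ abN j).
by rewrite -res_j cfRes1 => chi1; rewrite chi1 Order.POrderTheory.ltxx in nonlin.
Qed.

Theorem theorem4 (gT : finGroupType) (G : {group gT}) :
  abelian_by_metanilpotent G ->
  forall i1 i2 i3 : Iirr G,
    i1 != i2 -> i1 != i3 -> i2 != i3 ->
    (1 < 'chi_i1 1%g)%R -> (1 < 'chi_i2 1%g)%R -> (1 < 'chi_i3 1%g)%R ->
    exists g, g \in G /\
      [\/ 'chi_i1 g = 0 /\ 'chi_i2 g = 0,
          'chi_i1 g = 0 /\ 'chi_i3 g = 0 |
          'chi_i2 g = 0 /\ 'chi_i3 g = 0]%R.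
Proof.
move=> [N [K [nsNG nsKG sNK [abN [nilKN nilGK]]]]] i1 i2 i3 _ _ _ nl1 nl2 nl3.
have sKG := normal_sub nsKG.
have nsNK : N <| K := normalS sNK sKG nsNG.
pose restr i := ('Res[K] 'chi[G]_i \in irr K)%R.
pose off i :=
  exists2 H : {group gT}, H \proper G & ('chi[G]_i \in 'CF(G, H))%R.
have dich i : restr i \/ off i by apply: cfRes_irr_or_vanish_off_proper.
have off_zero i j : off i -> off j ->
    exists2 g, g \in G & ('chi_i g = 0 /\ 'chi_j g = 0)%R.
  move=> [H1 pr1 chi1] [H2 pr2 chi2].
  exact: vanish_off_proper_common_zero pr1 pr2 chi1 chi2.
have restr_zero i j : (1 < 'chi_i 1%g)%R -> (1 < 'chi_j 1%g)%R ->
    restr i -> restr j ->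
    exists2 g, g \in G & ('chi_i g = 0 /\ 'chi_j g = 0)%R.
  move=> nli nlj irri irrj.
  have resoff k : (1 < 'chi_k 1%g)%R -> restr k ->
      exists2 H : {group gT}, H \proper K & ('Res[K] 'chi_k \in 'CF(K, H))%R.
    (* Restriction preserves the degree, so the restricted character is still non-linear. *)
    move=> nlk irrk; apply: abelian_nilpotent_vanish_off_proper nsNK _ _ _ _ => //.
    by rewrite cfRes1.
  have [[H1 pr1 chi1] [H2 pr2 chi2]] := (resoff i nli irri, resoff j nlj irrj).
  have [g Kg] := vanish_off_proper_common_zero _ _ _ _ _ _ pr1 pr2 chi1 chi2.
  by rewrite !cfResE // => zg; exists g => //; apply: (subsetP sKG).
have [r1|o1] := dich i1; have [r2|o2] := dich i2; have [r3|o3] := dich i3.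
- by have [g Gg zg] := restr_zero _ _ nl1 nl2 r1 r2; exists g; split; [|apply: Or31].
- by have [g Gg zg] := restr_zero _ _ nl1 nl2 r1 r2; exists g; split; [|apply: Or31].
- by have [g Gg zg] := restr_zero _ _ nl1 nl3 r1 r3; exists g; split; [|apply: Or32].
- by have [g Gg zg] := off_zero _ _ o2 o3; exists g; split; [|apply: Or33].
- by have [g Gg zg] := restr_zero _ _ nl2 nl3 r2 r3; exists g; split; [|apply: Or33].
- by have [g Gg zg] := off_zero _ _ o1 o3; exists g; split; [|apply: Or32].
- by have [g Gg zg] := off_zero _ _ o1 o2; exists g; split; [|apply: Or31].
- by have [g Gg zg] := off_zero _ _ o1 o2; exists g; split; [|apply: Or31].
Qed.
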